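(* Let $n\geq 2$ be an integer, let $a_1>1$ be a real number and let $a_2=-1$. For $j=1,2$ let $A_j$ be the $n\times n$ real matrix all of whose diagonal entries equal $a_j$, whose entry in row $1$ and column $n$ equals $1$, and all of whose other entries equal $0$. Then $(A_1,A_2)$ is a locally hypercyclic pair on $\mathbb{R}^n$ which is not hypercyclic. In particular, \[\{x\in\mathbb{R}^n : J_{(A_1,A_2)}(x)=\mathbb{R}^n\}=\{(x_1,0,\ldots,0)^t\in\mathbb{R}^n : x_1\in\mathbb{R}\}.\]
   Context: Here $\mathbb{N}=\{1,2,3,\ldots\}$ and $u^t$ denotes the transpose of $u$. Let $(T_1,T_2)$ be a pair of commuting real $n\times n$ matrices, regarded as linear operators on $X=\mathbb{R}^n$. The pair is hypercyclic if there exists $x\in X$ such that $\{T_1^{k_1}T_2^{k_2}x : k_1,k_2\in\mathbb{N}\cup\{0\}\}$ is dense in $X$. For $x\in X$, the extended limit set $J_{(T_1,T_2)}(x)$ is the set of all $y\in X$ for which there exist a sequence of vectors $x_m\to x$ in $X$ and sequences of non-negative integers $\{k_m^{(1)}\}_{m\in\mathbb{N}}$, $\{k_m^{(2)}\}_{m\in\mathbb{N}}$ with $k_m^{(1)}+k_m^{(2)}\to+\infty$ such that $T_1^{k_m^{(1)}}T_2^{k_m^{(2)}}x_m\to y$. The pair is locally hypercyclic if there exists $x\in X\setminus\{0\}$ with $J_{(T_1,T_2)}(x)=X$. *)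

(* Defs.v *)
From mathcomp Require Import all_boot all_order all_algebra.
From mathcomp Require Import all_classical all_reals all_analysis.

Set Implicit Arguments.
Unset Strict Implicit.
Unset Printing Implicit Defensive.

Import Order.TTheory GRing.Theory Num.Theory.
Import numFieldNormedType.Exports.

Local Open Scope classical_set_scope.
Local Open Scope ring_scope.

Definition hypercyclic_pair (R : realType) (n : nat) (T1 T2 : 'M[R]_n) : Prop :=
  exists x : 'cV[R]_n,
    dense [set y : 'cV[R]_n |
      exists k1 k2 : nat, y = T1 ^+ k1 *m T2 ^+ k2 *m x].

Definition extended_limit_set (R : realType) (n : nat) (T1 T2 : 'M[R]_n)
    (x : 'cV[R]_n) : set 'cV[R]_n :=
  [set y | exists (x_ : nat -> 'cV[R]_n) (k1 k2 : nat -> nat),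
    [/\ x_ m @[m --> \oo] --> x,
        (k1 m + k2 m)%N @[m --> \oo] --> \oo &
        T1 ^+ k1 m *m T2 ^+ k2 m *m x_ m @[m --> \oo] --> y]].

Definition locally_hypercyclic_pair (R : realType) (n : nat)
    (T1 T2 : 'M[R]_n) : Prop :=
  exists2 x : 'cV[R]_n, x != 0 & extended_limit_set T1 T2 x = setT.

(* Indices are 0-based: the off-diagonal 1 sits in row 0, column n.-1. It would
   land on the diagonal (and be dropped) if n were 1. *)
Definition corner_mx (R : realType) (n : nat) (a : R) : 'M[R]_n :=
  \matrix_(i < n, j < n)
    if i == j then a
    else if (i == 0%N :> nat) && (j == n.-1 :> nat) then 1
    else 0.

Definition first_axis_vector (R : realType) (n : nat) (t : R) : 'cV[R]_n :=
  \col_(i < n) if i == 0%N :> nat then t else 0.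

(* Main.v *)
Require Import Defs.
From mathcomp Require Import all_boot all_order all_algebra.
From mathcomp Require Import all_classical all_reals all_analysis.
From mathcomp Require Import ring lra.

(** Let E be the square-zero matrix with a single 1 in the upper right corner.
    Both matrices have the form a (1 + a^-1 E), so everything commutes and

      A1^k A2^l = (-1)^l a1^k (1 + (k / a1 - l) E)    [corner_pair_orbit].

    This map multiplies every coordinate except the first by (-1)^l a1^k, and
    on the first coordinate it also adds a multiple of the last one.

    Obstructions.  Since a1 > 1, the absolute values of the coordinates other
    than the first do not decrease.  For the last coordinate this excludes a
    dense orbit [not_hypercyclic_corner]; in the limit it shows that 0 belongs
    to J(x) only if x lies on the first axis [extended_limit_set_tail_le].

    Abundance.  Let x = (t, 0, ..., 0) and let y have nonzero last coordinate z
    and first coordinate w.  The preimage of y under A1^k A2^l has coordinates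
    of size O(a1^-k) away from the first, and its first coordinate is close to
    t as soon as

      w - (k / a1 - l) z - (-1)^l a1^k t

    is small compared with a1^k.  Given a large k, this is arranged by solving
    for l up to a bounded error, the parity of l being chosen so that
    (-1)^l t / z is nonnegative and hence the solution is not negative
    [head_steering].  So y is hit exactly from points arbitrarily close to x
    [first_axis_reaches], and as such y are dense, J(x) is the whole space
    [extended_limit_set_first_axis]. *)

Import Order.TTheory GRing.Theory Num.Theory.
Import numFieldNormedType.Exports.

Local Open Scope classical_set_scope.
Local Open Scope ring_scope.

(** * The semigroup generated by the pair *)

(** The parameters [c] form the one-parameter unipotent group generated by the
    square-zero matrix [delta_mx ord0 ord_max]. Writing the size as [p.+2]
    makes the first and last indices distinct by computation. *)
Definition shear (R : realType) (p : nat) (c : R) : 'M[R]_p.+2 :=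
  1%:M + c *: delta_mx ord0 ord_max.
Arguments shear {R p} c.

Lemma shearM (R : realType) (p : nat) (c d : R) :
  shear c *m shear d = shear (c + d) :> 'M[R]_p.+2.
Proof.
rewrite /shear mulmxDl !mulmxDr !mul1mx mulmx1 -scalemxAl -scalemxAr.
by rewrite mul_delta_mx_0 // !scaler0 addr0 -addrA -scalerDl [d + c]addrC.
Qed.

Lemma shear0 (R : realType) (p : nat) : shear 0 = 1%:M :> 'M[R]_p.+2.
Proof. by rewrite /shear scale0r addr0. Qed.

Lemma shear_head (R : realType) (p : nat) (c : R) (x : 'cV[R]_p.+2) :
  (shear c *m x) ord0 0 = x ord0 0 + c * x ord_max 0.
Proof.
rewrite /shear mulmxDl mul1mx -scalemxAl !mxE (bigD1 ord_max) //= big1 => [|i ni].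
  by rewrite mxE !eqxx mul1r addr0.
by rewrite mxE (negPf ni) andbF mul0r.
Qed.

Lemma shear_tail (R : realType) (p : nat) (c : R) (x : 'cV[R]_p.+2) (i : 'I_p.+2) :
  i != ord0 -> (shear c *m x) i 0 = x i 0.
Proof.
move=> ni; rewrite /shear mulmxDl mul1mx -scalemxAl !mxE big1 ?mulr0 ?addr0//.
by move=> j _; rewrite mxE (negPf ni) mul0r.
Qed.

(** Normalizing the diagonal to 1 exhibits the matrix as a scalar times an
    element of a one-parameter group, which makes powers trivial. *)
Lemma corner_mxE (R : realType) (p : nat) (a : R) :
  a != 0 -> corner_mx p.+2 a = a *: shear a^-1.
Proof.
move=> a0; apply/matrixP => i j; rewrite !mxE -!val_eqE /= mulrDr mulrA divff// mul1r.
case: (eqVneq (val i) (val j)) => [->|_]; last first.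
  by rewrite mulr0 add0r; case: ifP.
by case: (eqVneq (val j) 0%N) => [->|]; rewrite /= mulr1 addr0.
Qed.

Lemma corner_mxX (R : realType) (p : nat) (a : R) (k : nat) :
  a != 0 -> corner_mx p.+2 a ^+ k = a ^+ k *: shear (k%:R / a).
Proof.
move=> a0; elim: k => [|k IH]; first by rewrite !expr0 scale1r mul0r shear0.
rewrite exprSr IH corner_mxE// -[LHS]/(_ *m _) -scalemxAl -scalemxAr scalerA shearM.
by rewrite -exprSr -[k.+1]addn1 natrD mulrDl mul1r.
Qed.

(** The whole semigroup generated by the pair is explicit: a scalar
    [a ^+ k * (-1) ^+ l] times a shear.  The factor [-1] is what makes the shear
    parameter [k / a - l] take both signs, so the two exponents act as two
    opposite controls on the first coordinate. *)
Lemma corner_pair_orbit (R : realType) (p : nat) (a : R) (k l : nat) :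
  a != 0 ->
  corner_mx p.+2 a ^+ k *m corner_mx p.+2 (-1) ^+ l =
  (a ^+ k * (-1) ^+ l) *: shear (k%:R / a - l%:R).
Proof.
move=> a0; rewrite !corner_mxX ?oppr_eq0 ?oner_eq0//.
by rewrite -scalemxAl -scalemxAr scalerA shearM invrN invr1 mulrN1.
Qed.

(** * Expansion of the coordinates other than the first *)

(** A shear moves only the first coordinate, so the others just get
    rescaled. *)
Lemma norm_orbit_tail (R : realType) (p : nat) (a : R) (k l : nat)
    (x : 'cV[R]_p.+2) (i : 'I_p.+2) :
  1 < a -> i != ord0 ->
  `|(corner_mx p.+2 a ^+ k *m corner_mx p.+2 (-1) ^+ l *m x) i 0| =
  a ^+ k * `|x i 0|.
Proof.
move=> a1 ni; have a0 : 0 < a by lra.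
rewrite corner_pair_orbit ?gt_eqF// -scalemxAl mxE shear_tail//.
by rewrite -mulrA normrM normrMsign ger0_norm// exprn_ge0// ltW.
Qed.

Lemma tail_orbit_expanding (R : realType) (p : nat) (a : R) (k l : nat)
    (x : 'cV[R]_p.+2) (i : 'I_p.+2) :
  1 < a -> i != ord0 ->
  `|x i 0| <=
  `|(corner_mx p.+2 a ^+ k *m corner_mx p.+2 (-1) ^+ l *m x) i 0|.
Proof.
by move=> a1 ni; rewrite norm_orbit_tail// ler_peMl// exprn_ege1// ltW.
Qed.

(** The last coordinate obstructs density: along an orbit its absolute value
    is [a ^+ k] times the initial one, hence either always zero or bounded
    below by a positive number. *)
Lemma not_hypercyclic_corner (R : realType) (p : nat) (a : R) :
  1 < a -> ~ hypercyclic_pair (corner_mx p.+2 a) (corner_mx p.+2 (-1)).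
Proof.
move=> a1 [x xd].
pose last_coord (y : 'cV[R]_p.+2) := `|y ord_max 0|.
have last_cont : continuous last_coord.
  by move=> y; apply: continuous_comp; [exact: coord_continuous|exact: norm_continuous].
have [x0|x0] := eqVneq (x ord_max 0) 0.
- have [] := xd (last_coord @^-1` [set r | 0 < r]).
  + by exists (const_mx 1); rewrite /= /last_coord mxE normr1.
  + by apply: open_comp => [y _|]; [exact: last_cont|exact: open_gt].
  + move=> z [+ [k [l zE]]].
    by rewrite zE /= /last_coord norm_orbit_tail// x0 normr0 mulr0 ltxx.
- have [] := xd (last_coord @^-1` [set r | r < `|x ord_max 0|]).
  + by exists 0; rewrite /= /last_coord mxE normr0 normr_gt0.
  + by apply: open_comp => [y _|]; [exact: last_cont|exact: open_lt].
  + by move=> z [+ [k [l zE]]]; rewrite zE /= /last_coord ltNge tail_orbit_expanding.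
Qed.

(** The orbit maps do not contract the coordinates other than the first, and
    this passes to the limit.  With [y = 0] it forces [x] onto the first
    axis. *)
Lemma extended_limit_set_tail_le (R : realType) (p : nat) (a : R)
    (x y : 'cV[R]_p.+2) (i : 'I_p.+2) :
  1 < a -> i != ord0 ->
  extended_limit_set (corner_mx p.+2 a) (corner_mx p.+2 (-1)) x y ->
  `|x i 0| <= `|y i 0|.
Proof.
move=> a1 ni [x_ [k [l [xx _ yy]]]].
have coord_cvg (u_ : nat -> 'cV[R]_p.+2) (u : 'cV[R]_p.+2) :
    u_ m @[m --> \oo] --> u -> `|u_ m i 0| @[m --> \oo] --> `|u i 0|.
  move=> uu; apply: cvg_norm.
  exact: (cvg_comp _ _ uu (@coord_continuous R p.+2 1 i 0 u)).
apply: ler_cvg_to (coord_cvg _ _ xx) (coord_cvg _ _ yy) _.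
by apply: nearW => m; exact: tail_orbit_expanding.
Qed.

(** * Steering the first coordinate *)

(** The sign of [(-1) ^+ l] has to be prescribed while [l] tracks a large real
    number; fixing the parity costs an error of at most 2 instead of 1. *)
Lemma exists_nat_parity_near (R : realType) (b : bool) (r : R) : 1 <= r ->
  exists2 l : nat, odd l = b & `|l%:R - r| < 2.
Proof.
move=> r1; pose q := Num.truncn ((r - b%:R) / 2).
have b1 : (b%:R : R) <= 1 by case: (b).
have /andP[q1 q2] : q%:R <= (r - b%:R) / 2 < q.+1%:R by apply: truncn_itv; lra.
exists (b + q.*2)%N; first by rewrite oddD odd_double addbF oddb.
rewrite natrD -muln2 natrM; rewrite -[q.+1%:R]natr1 in q2.
by rewrite ltr_norml; apply/andP; split; lra.
Qed.

Lemma exists_expr_large (R : realType) (a e A B : R) (K : nat) :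
  1 < a -> 0 < e ->
  exists k : nat, [/\ (K <= k)%N, A <= k%:R & B < a ^+ k * e].
Proof.
move=> a1 e0; have a0 : 0 < a by lra.
suff : \forall k \near \oo, [/\ (K <= k)%N, A <= k%:R & B < a ^+ k * e].
  by move=> /filter_ex.
have ia : `|a^-1| < 1 by rewrite gtr0_norm ?invr_gt0// invf_lt1.
have e1 : 0 < e / (`|B| + 1) by rewrite divr_gt0// ltr_wpDl.
have /cvgr0Pnorm_lt/(_ _ e1) small := cvg_expr ia.
near=> k; split.
- by near: k; exact: nbhs_infty_ge.
- by near: k; exact: nbhs_infty_ger.
- have : `|a^-1 ^+ k| < e / (`|B| + 1) by near: k.
  rewrite exprVn gtr0_norm ?invr_gt0 ?exprn_gt0// ltr_pdivlMr ?ltr_wpDl//.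
  rewrite mulrC ltr_pdivrMr ?exprn_gt0// mulrC => h.
  by apply: le_lt_trans h; rewrite (le_trans (ler_norm _))// lerDl.
Unshelve. all: by end_near. Qed.

(** To land exactly on a vector [y] with first and last coordinates [w] and
    [z], one applies the inverse orbit map to [y]; its first coordinate is
    within [e] of [t] exactly when the stated inequality holds.  It holds when
    [l] is within a bounded distance of the real number
    [k / a - w / z + a ^+ k * (-1) ^+ l * (t / z)], because [a ^+ k * e]
    eventually exceeds any bound.  That number is a legitimate target for a
    natural number once the parity of [l] makes its last term nonnegative,
    whatever the sign of [t / z].  The bound [B] leaves room for the other
    coordinates of the starting vector. *)
Lemma head_steering (R : realType) (a t w z e B : R) (K : nat) :
  1 < a -> z != 0 -> 0 < e ->
  exists k l : nat, [/\ (K <= k)%N, B < a ^+ k * e &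
    `|w - (k%:R / a - l%:R) * z - a ^+ k * (-1) ^+ l * t| < a ^+ k * e].
Proof.
move=> a1 z0 e0; have a0 : 0 < a by lra.
(* [k / a >= 1 + |w / z|] makes the target of [l] at least 1; the summand
   [2 * |z|] absorbs the rounding error of [l], multiplied by [z]. *)
have [k [Kk kA]] :=
  @exists_expr_large _ a e (a * (1 + `|w / z|)) (`|B| + 2 * `|z|) K a1 e0.
move=> kB; have zp : 0 < `|z| by rewrite normr_gt0.
have B0 : 0 <= `|B| by [].
have [b bt] : exists b : bool, 0 <= (-1) ^+ b * (t / z).
  by exists (t / z < 0); rewrite mulr_sign; case: ltP => // /ltW; rewrite oppr_ge0.
(* The real value of [l] for which the first coordinate would be exact. *)
pose r := k%:R / a - w / z + a ^+ k * ((-1) ^+ b * (t / z)).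
have r1 : 1 <= r.
  have h1 : 1 + `|w / z| <= k%:R / a by rewrite ler_pdivlMr// mulrC.
  have h2 := ler_norm (w / z).
  have h3 : 0 <= a ^+ k * ((-1) ^+ b * (t / z)).
    by rewrite mulr_ge0// exprn_ge0// ltW.
  by rewrite /r; lra.
have [l lb lr] := @exists_nat_parity_near _ b r r1.
exists k, l; split => //; first by have := ler_norm B; lra.
have -> : w - (k%:R / a - l%:R) * z - a ^+ k * (-1) ^+ l * t = (l%:R - r) * z.
  rewrite -signr_odd lb /r; set s := (-1) ^+ b; set A := a ^+ k.
  by field; rewrite z0 gt_eqF.
rewrite normrM; apply: (@lt_le_trans _ _ (2 * `|z|)); first by rewrite ltr_pM2r.
by lra.
Qed.

(** * Extended limit sets of the vectors of the first axis *)

Lemma ltr_norm_cV (R : realType) (p : nat) (x : 'cV[R]_p) (e : R) :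
  0 < e -> (forall i, `|x i 0| < e) -> `|x| < e.
Proof.
move=> e0 h; rewrite -[`|x|]/(mx_norm x) mx_normrE.
by apply: bigmax_lt => // -[i j] _ /=; rewrite (ord1 j).
Qed.

Lemma ler_coord_norm_cV (R : realType) (p : nat) (x : 'cV[R]_p) (i : 'I_p) :
  `|x i 0| <= `|x|.
Proof.
rewrite -[`|x|]/(mx_norm x) mx_normrE.
by apply: (le_trans _ (le_bigmax _ _ (i, 0))).
Qed.

(** The starting vector is the preimage of [y] under the orbit map.  Its
    coordinates other than the first are those of [y] divided by
    [a ^+ k] up to sign, hence small, and [head_steering] handles the first one. *)
Lemma first_axis_reaches (R : realType) (p : nat) (a t e : R) (K : nat)
    (y : 'cV[R]_p.+2) :
  1 < a -> 0 < e -> y ord_max 0 != 0 ->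
  exists x k l, [/\ `|x - first_axis_vector p.+2 t| < e, (K <= k)%N &
    corner_mx p.+2 a ^+ k *m corner_mx p.+2 (-1) ^+ l *m x = y].
Proof.
move=> a1 e0 y0; have a0 : 0 < a by lra.
have [k [l [Kk yk hk]]] :=
  @head_steering _ a t (y ord0 0) (y ord_max 0) e `|y| K a1 y0 e0.
pose s : R := (-1) ^+ l; have ss : s * s = 1 by rewrite -expr2 sqrr_sign.
have Ak0 : 0 < a ^+ k by exact: exprn_gt0.
pose c := k%:R / a - l%:R.
pose x := ((a ^+ k)^-1 * s) *: (shear (- c) *m y).
have sn r : `|s * r| = `|r| by rewrite /s normrMsign.
exists x, k, l; split => //; last first.
  rewrite corner_pair_orbit ?gt_eqF// /x -scalemxAl -scalemxAr scalerA mulmxA.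
  rewrite shearM subrr shear0 mul1mx -/s mulrACA ss mulr1 divff ?gt_eqF//.
  by rewrite scale1r.
apply: ltr_norm_cV => // i.
have -> : (x - first_axis_vector p.+2 t) i 0 =
    (a ^+ k)^-1 * s * (shear (- c) *m y) i 0 - (if i == 0%N :> nat then t else 0).
  by rewrite mxE [x i 0]mxE; congr (_ + _); rewrite !mxE.
have [->|ni] := eqVneq i ord0.
  rewrite shear_head /=.
  rewrite -(ltr_pM2l Ak0) -{1}(gtr0_norm Ak0) -normrM -sn; congr (`|_| < _): hk.
  rewrite -/s -/c; set A := a ^+ k in Ak0 *.
  transitivity (s * s * (y ord0 0 - c * y ord_max 0) - A * s * t).
    by rewrite ss mul1r.
  by field; rewrite gt_eqF.
rewrite shear_tail// (negPf (_ : val i != 0%N))//.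
rewrite subr0 -mulrA normrM sn gtr0_norm ?invr_gt0// mulrC ltr_pdivrMr// mulrC.
exact: le_lt_trans (ler_coord_norm_cV _ _ y i) yk.
Qed.

(** The shears act through the last coordinate, so the targets that can be hit
    by steering are those where it is nonzero; they are dense, which is enough
    for limit sets. *)
Lemma approx_last_neq0 (R : realType) (p : nat) (y : 'cV[R]_p.+2) (e : R) :
  0 < e -> exists2 z : 'cV[R]_p.+2, `|y - z| < e & z ord_max 0 != 0.
Proof.
move=> e0; have [y0|y0] := eqVneq (y ord_max 0) 0; last first.
  by exists y => //; rewrite subrr normr0.
exists (y + const_mx (e / 2)); last by rewrite !mxE y0 add0r gt_eqF// divr_gt0.
apply: ltr_norm_cV => // i; rewrite !mxE opprD addNKr normrN gtr0_norm; lra.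
Qed.

(** A diagonal argument: the [m]-th term hits, from within [1 / (m + 1)] of
    the base point and with first exponent at least [m], a target within
    [1 / (m + 1)] of [y]. *)
Lemma extended_limit_set_first_axis (R : realType) (p : nat) (a t : R) :
  1 < a ->
  extended_limit_set (corner_mx p.+2 a) (corner_mx p.+2 (-1))
    (first_axis_vector p.+2 t) = setT.
Proof.
move=> a1; apply/seteqP; split => // y _.
have /choice[f fP] m : exists q : 'cV[R]_p.+2 * (nat * nat),
    [/\ `|first_axis_vector p.+2 t - q.1| < m.+1%:R^-1, (m <= q.2.1)%N &
      `|y - corner_mx p.+2 a ^+ q.2.1 *m corner_mx p.+2 (-1) ^+ q.2.2 *m q.1|
        < m.+1%:R^-1].
  have e0 : 0 < m.+1%:R^-1 :> R by rewrite invr_gt0.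
  have [z yz z0] := approx_last_neq0 _ _ y _ e0.
  have [x [k [l [xt mk xz]]]] := @first_axis_reaches _ _ a t _ m z a1 e0 z0.
  by exists (x, (k, l)); split; rewrite //= ?xz// distrC.
exists (fun m => (f m).1), (fun m => (f m).2.1), (fun m => (f m).2.2); split.
- apply/cvgrPdist_lt => e e0; near=> m; have [+ _ _] := fP m.
  by move=> /lt_trans; apply; near: m; exact: near_infty_natSinv_lt (PosNum e0).
- apply/cvgnyPge => A; near=> m; have [_ mk _] := fP m.
  rewrite (leq_trans _ (leq_addr _ _))// (leq_trans _ mk)//.
  by near: m; exact: nbhs_infty_ge.
- apply/cvgrPdist_lt => e e0; near=> m; have [_ _] := fP m.
  by move=> /lt_trans; apply; near: m; exact: near_infty_natSinv_lt (PosNum e0).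
Unshelve. all: by end_near. Qed.

Theorem theorem5p4 (R : realType) (n : nat) (hn : (2 <= n)%N)
    (a1 a2 : R) (ha1 : 1 < a1) (ha2 : a2 = -1) :
  let A1 := corner_mx n a1 in
  let A2 := corner_mx n a2 in
  [/\ A1 *m A2 = A2 *m A1,
      locally_hypercyclic_pair A1 A2,
      ~ hypercyclic_pair A1 A2 &
      [set x : 'cV[R]_n | extended_limit_set A1 A2 x = setT] =
      [set first_axis_vector n t | t in [set: R]]].
Proof.
case: n hn => [//|[//|p]] _ A1 A2; rewrite /A1 /A2 {A1 A2} ha2; split.
- have a1_neq0 : a1 != 0 by rewrite gt_eqF// (lt_trans ltr01).
  rewrite !corner_mxE ?oppr_eq0 ?oner_eq0//.
  rewrite -!scalemxAl -!scalemxAr !shearM scalerA [in RHS]scalerA.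
  by rewrite mulrC [in RHS]addrC.
- exists (first_axis_vector p.+2 1); last exact: extended_limit_set_first_axis.
  by apply/eqP => /matrixP/(_ ord0 0)/eqP; rewrite !mxE /= oner_eq0.
- exact: not_hypercyclic_corner.
- apply/seteqP; split => [x /= Jx|_ [t _ <-]]; last exact: extended_limit_set_first_axis.
  exists (x ord0 0) => //; apply/matrixP => i j; rewrite (ord1 j) !mxE.
  have [->//|ni] := eqVneq i ord0.
  rewrite (negPf (_ : val i != 0%N))//.
  have J0 : extended_limit_set (corner_mx p.+2 a1) (corner_mx p.+2 (-1)) x 0.
    by rewrite Jx.
  have := @extended_limit_set_tail_le _ _ _ _ _ i ha1 ni J0.
  by rewrite mxE normr0 normr_le0 => /eqP.
Qed.
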